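(* If $A$ is a strongly Jacobson ring, then the univariate polynomial ring $A[X]$ is strongly Jacobson.
   Context: All rings are commutative with identity (the trivial ring is allowed). For a subset $U$ of a ring $A$, $\langle U\rangle$ denotes the ideal generated by $U$. $\mathrm{Nil}_A 0:=\{x\in A:\exists n\ge 0,\ x^n=0\}$ is the nilradical. The image of an element in a quotient ring is denoted by the same letter. For a ring $A$ and $x,x'\in A$, the proposition ''the triple $(A,x,x')$ is strongly Jacobson'' is inductively generated by the following constructors (simultaneously for all quotients of $A$ by finitely generated ideals): (1) if $x'\in\mathrm{Nil}_A 0$, then $(A,x,x')$ is strongly Jacobson; (2) if there exist $n\ge 0$ and $a_{1,1},\ldots,a_{1,n}\in A$ such that for any $a_{2,1},\ldots,a_{2,n}\in A$ the triple $(A/\langle 1-a_{2,i}(1-a_{1,i}x):i\in\{1,\ldots,n\}\rangle,\,x,\,x')$ is strongly Jacobson, then $(A,x,x')$ is strongly Jacobson. A ring $A$ is called strongly Jacobson if $(A,x,x)$ is strongly Jacobson for all $x\in A$. *)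

(* Defs.v *)
From HB Require Import structures.
From mathcomp Require Import all_boot all_algebra.
From mathcomp Require Import boolp functions.

Set Implicit Arguments.
Unset Strict Implicit.
Unset Printing Implicit Defensive.

Import GRing.Theory.

Local Open Scope ring_scope.
Local Open Scope quotient_scope.

(* Rings are [comPzRingType]s, so that the trivial ring is allowed. Neither
   the quotient rings of ring_quotient.v (quotients by proper ideals) nor
   [{poly A}] cover the trivial ring; hence the two constructions below. *)

Section FgQuotient.

Variables (A : comPzRingType) (n : nat) (u : 'I_n -> A).

Definition fgideal : {pred A} :=
  fun y => `[< exists c : 'I_n -> A, y = \sum_(i < n) c i * u i >].

Lemma fgidealP y :
  reflect (exists c : 'I_n -> A, y = \sum_(i < n) c i * u i) (y \in fgideal).
Proof. exact: asboolP. Qed.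

Lemma fgideal_zmod_closed : zmod_closed fgideal.
Proof.
split=> [|_ _ /fgidealP[c ->] /fgidealP[d ->]]; apply/fgidealP.
  by exists (fun=> 0); rewrite big1 // => i _; rewrite mul0r.
exists (fun i => c i - d i); rewrite -sumrB.
by apply: eq_bigr => i _; rewrite mulrBl.
Qed.

HB.instance Definition _ :=
  GRing.isZmodClosed.Build A fgideal fgideal_zmod_closed.

Lemma fgidealMl a y : y \in fgideal -> a * y \in fgideal.
Proof.
move=> /fgidealP[c ->]; apply/fgidealP; exists (fun i => a * c i).
by rewrite mulr_sumr; under [RHS]eq_bigr do rewrite -mulrA.
Qed.

Definition fgquot : Type := {ideal_quot fgideal}.

HB.instance Definition _ := GRing.Zmodule.on fgquot.
HB.instance Definition _ := EqQuotient.on fgquot.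

Definition fgpi (x : A) : fgquot := \pi_fgquot x.

Lemma fgpi_surj (q : fgquot) : exists x : A, fgpi x = q.
Proof. by exists (repr q); exact: reprK. Qed.

Lemma fgpi_eq (x y : A) : fgpi x = fgpi y <-> x - y \in fgideal.
Proof.
have E : (x - y \in fgideal) = (fgpi x == fgpi y) := Quotient.idealrBE _ _ _.
by split=> [/eqP|H]; [rewrite -E | apply/eqP; rewrite -E].
Qed.

Definition fgquot_one : fgquot := fgpi 1.
Definition fgquot_mul (a b : fgquot) : fgquot := fgpi (repr a * repr b).

Lemma fgpiD (x y : A) : fgpi (x + y) = fgpi x + fgpi y.
Proof. exact: Quotient.pi_add. Qed.

Lemma fgpiM (x y : A) : fgpi (x * y) = fgquot_mul (fgpi x) (fgpi y).
Proof.
apply/fgpi_eq; set x' := repr _; set y' := repr _.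
have -> : x * y - x' * y' = y * (x - x') + x' * (y - y').
  by rewrite !mulrBr (mulrC y x) (mulrC y x') addrA subrK.
by rewrite rpredD ?fgidealMl //; apply/fgpi_eq; rewrite /fgpi reprK.
Qed.

Lemma fgquot_mulA : associative fgquot_mul.
Proof.
move=> a b c; have [x <-] := fgpi_surj a.
have [y <-] := fgpi_surj b; have [z <-] := fgpi_surj c.
by rewrite -(fgpiM y) -(fgpiM x y) -(fgpiM x) -fgpiM mulrA.
Qed.

Lemma fgquot_mulC : commutative fgquot_mul.
Proof. by move=> a b; rewrite /fgquot_mul mulrC. Qed.

Lemma fgquot_mul1 : left_id fgquot_one fgquot_mul.
Proof. by move=> a; have [x <-] := fgpi_surj a; rewrite -(fgpiM 1) mul1r. Qed.

Lemma fgquot_mulDl : left_distributive fgquot_mul +%R.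
Proof.
move=> a b c; have [x <-] := fgpi_surj a.
have [y <-] := fgpi_surj b; have [z <-] := fgpi_surj c.
by rewrite -fgpiD -!(fgpiM _ z) mulrDl fgpiD.
Qed.

HB.instance Definition _ := GRing.Zmodule_isComPzRing.Build fgquot
  fgquot_mulA fgquot_mulC fgquot_mul1 fgquot_mulDl.

Lemma fgpi_is_zmod_morphism : zmod_morphism fgpi.
Proof.
move=> x y; apply: (addIr (fgpi y)).
by rewrite -fgpiD !subrK.
Qed.

Lemma fgpi_is_monoid_morphism : monoid_morphism fgpi.
Proof. by split=> [|x y]; last exact: fgpiM. Qed.

HB.instance Definition _ :=
  GRing.isZmodMorphism.Build A fgquot fgpi fgpi_is_zmod_morphism.
HB.instance Definition _ :=
  GRing.isMonoidMorphism.Build A fgquot fgpi fgpi_is_monoid_morphism.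

Lemma fgpi_eq0 (x : A) : fgpi x = 0 <-> x \in fgideal.
Proof. by rewrite -{2}[x]subr0 -fgpi_eq raddf0. Qed.

End FgQuotient.

Arguments fgpi {A n} u x.

Definition in_nilradical (A : comPzRingType) (x : A) : Prop :=
  exists n : nat, x ^+ n = 0.

(* The predicate is defined on all triples at once: the constructors only lead
   from A to quotients of A by finitely generated ideals. *)
Inductive strongly_jacobson_triple :
    forall A : comPzRingType, A -> A -> Prop :=
| SJ_nil (A : comPzRingType) (x x' : A) :
    in_nilradical x' -> strongly_jacobson_triple x x'
| SJ_quot (A : comPzRingType) (x x' : A) (n : nat) (a1 : 'I_n -> A) :
    (forall a2 : 'I_n -> A,
       let u (i : 'I_n) : A := 1 - a2 i * (1 - a1 i * x) in
       strongly_jacobson_triple (fgpi u x) (fgpi u x')) ->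
    strongly_jacobson_triple x x'.

Definition strongly_jacobson (A : comPzRingType) : Prop :=
  forall x : A, strongly_jacobson_triple x x.

(* A[X] as the ring of finitely supported coefficient sequences with the
   convolution product. *)
Section PolyRing.

Variable A : comPzRingType.

Definition finsupp_seq : {pred nat -> A} :=
  fun f => `[< exists n : nat, forall i : nat, (n <= i)%N -> f i = 0 >].

Lemma finsupp_seqP (f : nat -> A) :
  reflect (exists n : nat, forall i : nat, (n <= i)%N -> f i = 0)
          (f \in finsupp_seq).
Proof. exact: asboolP. Qed.

Lemma finsupp_seq_zmod_closed : zmod_closed finsupp_seq.
Proof.
split=> [|f g /finsupp_seqP[m fm] /finsupp_seqP[n gn]]; apply/finsupp_seqP.
  by exists 0%N.
exists (maxn m n) => i; rewrite geq_max => /andP[mi ni].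
by rewrite -[LHS]/(f i - g i) fm // gn // subrr.
Qed.

HB.instance Definition _ :=
  GRing.isZmodClosed.Build (nat -> A) finsupp_seq finsupp_seq_zmod_closed.

Record polyring := PolyRing {
  pcoef : nat -> A;
  _ : pcoef \in finsupp_seq
}.

HB.instance Definition _ := [isSub for pcoef].
HB.instance Definition _ := [Choice of polyring by <:].
HB.instance Definition _ := [SubChoice_isSubZmodule of polyring by <:].

Lemma pcoef_inj (p q : polyring) : (forall k, pcoef p k = pcoef q k) -> p = q.
Proof. by move=> pq; apply: val_inj; apply/funext. Qed.

Lemma pcoefD (p q : polyring) k : pcoef (p + q) k = pcoef p k + pcoef q k.
Proof. by []. Qed.

Definition conv (f g : nat -> A) : nat -> A :=
  fun k => \sum_(i < k.+1) f i * g (k - i)%N.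

Lemma finsupp_conv (p q : polyring) : conv (pcoef p) (pcoef q) \in finsupp_seq.
Proof.
have /finsupp_seqP[m pm] := valP p; have /finsupp_seqP[n qn] := valP q.
apply/finsupp_seqP; exists (m + n)%N => k mnk; rewrite /conv big1 // => i _.
have [mi|im] := leqP m i; first by rewrite [pcoef p _]pm ?mul0r.
rewrite [pcoef q _]qn ?mulr0 // leq_subRL; last by rewrite -ltnS.
by rewrite (leq_trans _ mnk) // leq_add2r ltnW.
Qed.

Definition finsupp_one : nat -> A := fun k => (k == 0%N)%:R.

Lemma finsupp_one_subproof : finsupp_one \in finsupp_seq.
Proof. by apply/finsupp_seqP; exists 1%N => -[]. Qed.

Definition polyring_one : polyring := PolyRing finsupp_one_subproof.
Definition polyring_mul (p q : polyring) : polyring :=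
  PolyRing (finsupp_conv p q).

Lemma conv_rev (f g : nat -> A) k :
  conv f g k = \sum_(i < k.+1) f (k - i)%N * g i.
Proof.
rewrite /conv (reindex_inj rev_ord_inj) /=.
by apply: eq_bigr => i _; rewrite (sub_ordK i).
Qed.

Lemma polyring_mulC : commutative polyring_mul.
Proof.
move=> p q; apply: pcoef_inj => k; rewrite /= conv_rev.
by apply: eq_bigr => i _; rewrite mulrC.
Qed.

Lemma polyring_mulA : associative polyring_mul.
Proof.
move=> p q r; apply: pcoef_inj => i; rewrite /= [RHS]conv_rev /conv.
pose coef3 j k := pcoef p j * (pcoef q (i - j - k)%N * pcoef r k).
transitivity (\sum_(j < i.+1) \sum_(k < i.+1 | (k <= i - j)%N) coef3 j k).
  apply: eq_bigr => /= j _; rewrite -/(conv _ _ _) conv_rev big_distrr /=.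
  by rewrite (big_ord_narrow_leq (leq_subr _ _)).
rewrite (exchange_big_dep predT) //=; apply: eq_bigr => k _.
transitivity (\sum_(j < i.+1 | (j <= i - k)%N) coef3 j k).
  apply: eq_bigl => j; rewrite -ltnS -(ltnS j) -!subSn ?leq_ord //.
  by rewrite -subn_gt0 -(subn_gt0 j) -!subnDA addnC.
rewrite (big_ord_narrow_leq (leq_subr _ _)) big_distrl /=.
by apply: eq_bigr => j _; rewrite /coef3 -!subnDA addnC mulrA.
Qed.

Lemma polyring_mul1 : left_id polyring_one polyring_mul.
Proof.
move=> p; apply: pcoef_inj => k.
rewrite /= /conv big_ord_recl /= mul1r subn0 big1 ?addr0 // => i _.
by rewrite mul0r.
Qed.

Lemma polyring_mulDl : left_distributive polyring_mul +%R.
Proof.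
move=> p q r; apply: pcoef_inj => k; rewrite pcoefD /= /conv -big_split /=.
by apply: eq_bigr => i _; rewrite -mulrDl.
Qed.

HB.instance Definition _ := GRing.Zmodule_isComPzRing.Build polyring
  polyring_mulA polyring_mulC polyring_mul1 polyring_mulDl.

End PolyRing.

(* On nontrivial rings the construction agrees with [{poly A}]. *)
Lemma polyringP (A : comNzRingType) :
  exists2 f : {rmorphism {poly A} -> polyring A},
    bijective f & forall p k, pcoef (f p) k = p`_k.
Proof.
have fsP (p : {poly A}) : (fun k => p`_k) \in @finsupp_seq A.
  by apply/finsupp_seqP; exists (size p) => i; exact: nth_default.
pose f (p : {poly A}) : polyring A := PolyRing (fsP p).
have fB : zmod_morphism f by move=> p q; apply: pcoef_inj => k; exact: coefB.
have fM : monoid_morphism f.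
  split=> [|p q]; apply: pcoef_inj => k; first exact: coef1.
  exact: coefM.
pose fz := GRing.isZmodMorphism.Build _ _ f fB.
pose fm := GRing.isMonoidMorphism.Build _ _ f fM.
pose F : {rmorphism {poly A} -> polyring A} := HB.pack f fz fm.
exists F => //.
have bound (q : polyring A) : exists n, forall i, (n <= i)%N -> pcoef q i = 0.
  by apply/finsupp_seqP; exact: valP q.
pose g (q : polyring A) : {poly A} :=
  \poly_(i < projT1 (cid (bound q))) pcoef q i.
exists g => [p | q]; [apply/polyP => k | apply: pcoef_inj => k];
  rewrite /= coef_poly; case: cid => n nP /=;
  by case: ltnP => // /nP /esym.
Qed.

(* Main.v *)
(* Read the definition of strongly Jacobson as a covering game on ideals J of
   R = A[X]: one may adjoin an inverse of 1 - a f to the quotient by J for any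
   chosen a, and wants to make f nilpotent. Playing a = X gives u in J with
   g (1 - X f) = 1 - u, so that f is nilpotent modulo the coefficients of u.
   It remains to make c f nilpotent, for c the top coefficient of u, and to
   continue modulo c. Modulo u, some c^k f satisfies a monic equation; let b be
   its constant term. The constant c b is a multiple of f, so inverses of
   the elements 1 - a c b can be adjoined to A[X] / J; they are integral over
   A[1/c], and c is invertible modulo 1 - a c b, hence they already lie in A.
   The strategy for c b in A therefore makes c b nilpotent, and modulo b one is
   left with a monic equation of lower degree, or with f = 0. *)

Require Import Defs.
From HB Require Import structures.
From mathcomp Require Import all_boot all_algebra.
From mathcomp Require Import boolp ring.

Set Implicit Arguments.
Unset Strict Implicit.
Unset Printing Implicit Defensive.

Import GRing.Theory.

Local Open Scope ring_scope.

(** * Ideals and radicals *)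

Section Ideals.

Variable R : comPzRingType.
Implicit Types (I J K : R -> Prop) (a b x y z : R).

Definition is_ideal J : Prop :=
  [/\ J 0, forall x y, J x -> J y -> J (x + y) & forall a x, J x -> J (a * x)].

Definition subideal I J : Prop := forall x, I x -> J x.

Definition radical J : R -> Prop := fun x => exists n, J (x ^+ n).

Definition adjoin J a : R -> Prop := fun x => exists b, J (x - b * a).

Lemma ideal_sum J (T : Type) (r : seq T) (P : pred T) (F : T -> R) :
  is_ideal J -> (forall i, P i -> J (F i)) -> J (\sum_(i <- r | P i) F i).
Proof. by move=> [J0 JD _] JF; apply: (big_ind J). Qed.

Lemma idealN J x : is_ideal J -> J x -> J (- x).
Proof. by move=> [_ _ JM] Jx; rewrite -mulN1r; apply: JM. Qed.

Lemma idealB J x y : is_ideal J -> J x -> J y -> J (x - y).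
Proof. by move=> idJ Jx Jy; have [_ + _] := idJ; apply=> //; apply: idealN. Qed.

Lemma idealMr J x a : is_ideal J -> J x -> J (x * a).
Proof. by move=> [_ _ JM] Jx; rewrite mulrC; apply: JM. Qed.

Lemma ideal_radical J : is_ideal J -> is_ideal (radical J).
Proof.
move=> idJ; have [J0 JD JM] := idJ; split; first by exists 1%N.
  move=> x y [m Jx] [n Jy]; exists (m + n)%N; rewrite exprDn.
  apply: ideal_sum => // i _; rewrite -mulr_natr; apply: idealMr => //.
  have [ni|/ltnW ni] := leqP n i.
    by apply: (JM); rewrite -(subnK ni) exprD; apply: JM.
  apply: idealMr => //.
  by rewrite -addnBA // addnC exprD; apply: JM.
by move=> a x [n Jx]; exists n; rewrite exprMn; apply: JM.
Qed.

Lemma subideal_radical J : subideal J (radical J).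
Proof. by move=> x Jx; exists 1%N. Qed.

Lemma radicalS I J : subideal I J -> subideal (radical I) (radical J).
Proof. by move=> IJ x [n Ix]; exists n; apply: IJ. Qed.

Lemma radical_exp J n x : radical J (x ^+ n) -> radical J x.
Proof. by move=> [k]; rewrite -exprM => Jx; exists (n * k)%N. Qed.

Lemma ideal_adjoin J a : is_ideal J -> is_ideal (adjoin J a).
Proof.
move=> [J0 JD JM]; split; first by exists 0; rewrite mul0r subrr.
  move=> x y [b Jx] [c Jy]; exists (b + c).
  by have := JD _ _ Jx Jy; congr J; ring.
by move=> c x [b Jx]; exists (c * b); have := JM c _ Jx; congr J; ring.
Qed.

Lemma adjoin_sub J a : subideal J (adjoin J a).
Proof. by move=> x Jx; exists 0; rewrite mul0r subr0. Qed.

Lemma adjoin_gen J a : is_ideal J -> adjoin J a a.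
Proof. by move=> [J0 _ _]; exists 1; rewrite mul1r subrr. Qed.

Lemma adjoinS I J a : subideal I J -> subideal (adjoin I a) (adjoin J a).
Proof. by move=> IJ x [b Ix]; exists b; apply: IJ. Qed.

(** Modulo [J] some power of [x] is a multiple of [a], and [b] makes that multiple nilpotent. *)
Lemma radical_adjoinM J a b x :
  is_ideal J -> radical J (a * b) -> radical (adjoin J a) x ->
  radical J (b * x).
Proof.
move=> idJ Jab [n [c Jx]]; have idr := ideal_radical idJ.
have [_ rD rM] := idr.
apply: (@radical_exp _ n.+1); rewrite exprMn exprS exprSr.
have -> : b * b ^+ n * (x ^+ n * x) =
   (b ^+ n * b * x) * (x ^+ n - c * a) + (c * b ^+ n * x) * (a * b) by ring.
by apply: rD; apply: rM => //; apply: subideal_radical.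
Qed.

Lemma radical_adjoin_split J a b x :
  is_ideal J -> radical J (a * b) ->
  radical (adjoin J a) x -> radical (adjoin J b) x -> radical J x.
Proof.
move=> idJ Jab xa xb; apply: (@radical_exp _ 2); rewrite expr2.
by apply: (@radical_adjoinM _ b) => //; apply: (radical_adjoinM idJ Jab).
Qed.

End Ideals.

Lemma ideal_preim (R S : comPzRingType) (phi : {rmorphism R -> S})
    (J : S -> Prop) : is_ideal J -> is_ideal (fun x => J (phi x)).
Proof.
move=> [J0 JD JM]; split; first by rewrite rmorph0.
  by move=> x y; rewrite rmorphD; apply: JD.
by move=> a x; rewrite rmorphM; apply: JM.
Qed.

Lemma ideal0 (R : comPzRingType) : is_ideal (fun x : R => x = 0).
Proof.
split=> // [x y -> -> | a x ->]; first by rewrite addr0.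
by rewrite mulr0.
Qed.

(** * Units of polynomial rings *)

(** The product of the two top coefficients lies in [I], so it suffices to argue modulo each of
    them, which lowers one of the two bounds. *)
Lemma coef_unit_nilpotent (A : comNzRingType) (g w : {poly A}) (m n : nat)
    (I : A -> Prop) :
  is_ideal I ->
  (forall i, (m <= i)%N -> I g`_i) -> (forall i, (n <= i)%N -> I w`_i) ->
  (forall i, I (g * w - 1)`_i) ->
  forall i, radical I w`_i.+1.
Proof.
have [k] := ubnP (m + n); elim: k m n I => // k IHk m n I lek idI gm wn gw i.
have [I0 ID IM] := idI.
case: m => [|m] in lek gm *.
  have I1 : I 1.
    have -> : 1 = (g * w)`_0 - (g * w - 1)`_0.
      by rewrite coefB coef1 opprB addrC subrK.
    apply: idealB => //; rewrite coefM; apply: ideal_sum => // j _.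
    by apply: idealMr => //; apply: gm.
  by apply: subideal_radical; rewrite -[w`_ _]mulr1; apply: IM.
case: n => [|[|n]] in lek wn *; try by apply: subideal_radical; apply: wn.
have top : I (g`_m * w`_n.+1).
  have := gw (m + n.+1)%N; rewrite coefB coef1 addnS /= subr0 -addnS coefM.
  have lt_m : (m < (m + n.+1).+1)%N by rewrite ltnS leq_addr.
  rewrite (bigD1 (Ordinal lt_m)) //= addKn => Ig.
  have -> : g`_m * w`_n.+1 = (g`_m * w`_n.+1 +
     \sum_(j < (m + n.+1).+1 | j != Ordinal lt_m) g`_j * w`_(m + n.+1 - j)) -
     \sum_(j < (m + n.+1).+1 | j != Ordinal lt_m) g`_j * w`_(m + n.+1 - j).
    by rewrite addrK.
  apply: idealB => //; apply: ideal_sum => // j ne_jm.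
  have [lt_mj|le_jm] := ltnP m j; first by apply: idealMr => //; apply: gm.
  apply: IM; apply: wn.
  have {ne_jm le_jm} lt_jm : (j < m)%N.
    rewrite ltn_neqAle le_jm andbT.
    by apply: contra ne_jm => /eqP E; apply/eqP/val_inj.
  by rewrite ltn_subRL -addSn leq_add2r.
apply: (radical_adjoin_split idI (subideal_radical top)).
  apply: (IHk m n.+2) => //; first exact: ideal_adjoin.
  - move=> j; rewrite leq_eqVlt => /predU1P[<-|/gm Ig]; first exact: adjoin_gen.
    exact: adjoin_sub.
  - by move=> j /wn; apply: adjoin_sub.
  - by move=> j; apply: adjoin_sub.
apply: (IHk m.+1 n.+1) => //; first by rewrite addnS in lek.
- exact: ideal_adjoin.
- by move=> j /gm; apply: adjoin_sub.
- move=> j; rewrite leq_eqVlt => /predU1P[<-|/wn Ig]; first exact: adjoin_gen.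
  exact: adjoin_sub.
- by move=> j; apply: adjoin_sub.
Qed.

(** * Integral dependence modulo a polynomial *)

(** The coefficient of [u] in degree [n] is only formally leading and may vanish; each reduction
    costs one factor of it. *)
Lemma pseudo_division (A : comNzRingType) (u q : {poly A}) (n d : nat) :
  (size u <= n.+1)%N -> (size q <= n + d)%N ->
  exists w r : {poly A}, (u`_n ^+ d) *: q = w * u + r /\ (size r <= n)%N.
Proof.
move=> su; elim: d q => [|d IHd] q sq.
  by exists 0, q; rewrite expr0 scale1r mul0r add0r; rewrite addn0 in sq.
pose q' := u`_n *: q - q`_(n + d) *: (u * 'X^d).
have [|w [r [E sr]]] := IHd q'.
  apply/leq_sizeP => j; rewrite leq_eqVlt coefB !coefZ coefMXn => /predU1P[<-|lt_j].
    by rewrite ltnNge leq_addl /= addnK mulrC subrr.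
  rewrite [q`_j]nth_default ?mulr0 ?sub0r; last by rewrite (leq_trans sq) ?addnS.
  case: ifP => _; first by rewrite mulr0 oppr0.
  by rewrite [u`__]nth_default ?mulr0 ?oppr0 // (leq_trans su) // ltn_subRL addnC.
exists (w + (u`_n ^+ d * q`_(n + d)) *: 'X^d), r; split=> //.
move: E; rewrite /q' scalerBr exprSr -!scalerA => /eqP.
rewrite subr_eq => /eqP ->; rewrite -!mul_polyC ?polyCM; ring.
Qed.

(** Determinant trick: [M] describes multiplication by the scaled [t] on powers of X modulo [v], and
    its characteristic polynomial gives the monic equation. *)
Lemma pseudo_integral (A : comNzRingType) (u t : {poly A}) (n : nat) :
  (size u <= n.+1)%N ->
  exists k (p w : {poly A}), p \is monic /\ p \Po (u`_n ^+ k *: t) = w * u.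
Proof.
(* Multiplying u by X makes the family of powers of X below its degree
   nonempty, so that it contains 1. *)
move=> su; pose v := u * 'X; pose c := u`_n; pose N := n.+1.
have sv : (size v <= N.+1)%N.
  by rewrite (leq_trans (size_polyMleq _ _)) // size_polyX addn2.
have vc : v`_N = c by rewrite coefMX.
pose k := size t.
have /choice[w /choice[r wr]] : forall i : 'I_N, exists w r : {poly A},
    (c ^+ k) *: (t * 'X^i) = w * v + r /\ (size r <= N)%N.
  move=> i; rewrite -vc; apply: pseudo_division => //.
  rewrite (leq_trans (size_polyMleq _ _)) // size_polyXn addnS /=.
  by rewrite addnC leq_add2r ltnW.
pose M : 'M[A]_N := \matrix_(i, j) (r i)`_j.
pose T := c ^+ k *: t.
pose D : 'M[{poly A}]_N := T%:M - map_mx polyC M.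
have detD : char_poly M \Po T = \det D.
  rewrite /char_poly -[LHS]/(GRing.RMorphism.sort (comp_poly T) _).
  rewrite -det_map_mx; congr (\det _); apply/matrixP => i j.
  by rewrite !mxE rmorphB rmorphMn /= comp_polyX comp_polyC.
pose x : 'cV[{poly A}]_N := \col_i 'X^i.
have Dx : D *m x = v *: (\col_i w i).
  apply/matrixP => i j; rewrite mulmxBl mul_scalar_mx !mxE.
  have [E sr] := wr i; rewrite /T -scalerAl E mulrC -[RHS]addr0 -addrA.
  congr (_ + _); apply/eqP; rewrite subr_eq0; apply/eqP.
  rewrite -[LHS](take_poly_id sr) /take_poly poly_def.
  by apply: eq_bigr => l _; rewrite !mxE mul_polyC.
have : \adj D *m (D *m x) = v *: (\adj D *m \col_i w i).
  by rewrite Dx scalemxAr.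
(* Row 0 of [x] is 1, so this row exhibits [\det D] itself as a multiple of [v]. *)
rewrite mulmxA mul_adj_mx mul_scalar_mx => /matrixP/(_ ord0 ord0).
rewrite mxE [x _ _]mxE expr0 mulr1 -detD mxE => E.
exists k, (char_poly M), ('X * (\adj D *m \col_i w i) ord0 ord0).
split; first exact: char_poly_monic.
by rewrite E /v; ring.
Qed.

(* If s t = g modulo J, then s^m p(t) is the homogenization of p evaluated at
   (g, s). *)
Lemma comp_poly_homogenize (A : comNzRingType) (J : {poly A} -> Prop)
    (s g : A) (t p : {poly A}) (m : nat) :
  is_ideal J -> J (s%:P * t - g%:P) -> (size p <= m.+1)%N ->
  exists e, J ((s ^+ m)%:P * (p \Po t) - (p`_m * g ^+ m + s * e)%:P).
Proof.
move=> idJ Jt; have [J0 JD JM] := idJ; elim: m p => [|m IHm] p sp.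
  exists 0; rewrite (size1_polyC sp) comp_polyC coefC /= !expr0.
  by rewrite mul1r mulr1 mulr0 addr0 subrr.
pose q := drop_poly 1 p; pose a := p`_0.
have pE : p = q * 'X + a%:P.
  by apply/polyP => -[|i]; rewrite !coefE ?addr0 ?add0r ?addn1.
have sq : (size q <= m.+1)%N by rewrite size_drop_poly leq_subLR.
have [e Je] := IHm q sq; exists (e * g + s ^+ m * a).
rewrite pE comp_poly_MXaddC coefD coefMX coefC /= addr0.
set b := (q`_m * _ + _)%:P in Je.
have -> : (s ^+ m.+1)%:P * ((q \Po t) * t + a%:P) -
    (q`_m * g ^+ m.+1 + s * (e * g + s ^+ m * a))%:P =
  (s%:P * t) * ((s ^+ m)%:P * (q \Po t) - b) + b * (s%:P * t - g%:P).
  by rewrite /b !exprS; ring.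
by apply: (JD); apply: (JM).
Qed.

(** Let [c] be the coefficient of [u] in degree [n]. Homogenizing a monic equation of the scaled [t]
    makes a power of [c] a constant multiple of [s] modulo [J]; since [c * a = 1 - s], the same
    follows for 1. *)
Lemma integral_inverse (A : comNzRingType) (J : {poly A} -> Prop)
    (u t : {poly A}) (n : nat) (a s : A) :
  is_ideal J -> J u -> (size u <= n.+1)%N -> s = 1 - u`_n * a ->
  J (1 - t * s%:P) -> exists e, J (1 - e * s)%:P.
Proof.
move=> idJ Ju su sE Jt; have [J0 JD JM] := idJ.
have [k [p [w [p_monic pw]]]] := pseudo_integral t su.
pose c := u`_n; pose m := (size p).-1; pose N := (k * m)%N.
have Jct : J (s%:P * (c ^+ k *: t) - (c ^+ k)%:P).
  have := JM (- (c ^+ k)%:P) _ Jt; congr J.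
  by rewrite -mul_polyC; ring.
have [|e Je] := @comp_poly_homogenize _ _ _ _ _ p m idJ Jct.
  exact: leqSpred.
have pm : p`_m = 1 by have /monicP := p_monic.
have [d dE] : exists d, (c * a) ^+ N = 1 - s * d.
  have -> : c * a = 1 - s by rewrite sE /c; ring.
  exists (\sum_(i < N) (1 - s) ^+ i).
  by have /eqP := subrX1 (1 - s) N; rewrite subr_eq => /eqP ->; ring.
exists (d - e * a ^+ N).
have -> : (1 - (d - e * a ^+ N) * s)%:P =
  (a ^+ N)%:P * ((s ^+ m)%:P * (p \Po (c ^+ k *: t))
    - ((s ^+ m)%:P * (p \Po (c ^+ k *: t)) - (p`_m * (c ^+ k) ^+ m + s * e)%:P)).
  rewrite subKr pm mul1r -exprM -polyCM mulrDr -exprMn.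
  by rewrite -/N [a * c]mulrC dE; congr _%:P; ring.
apply: (JM); apply: idealB => //; apply: (JM); rewrite pw; exact: JM.
Qed.

(** * Covers *)

(* Quantifying over all larger ideals K, rather than over J enlarged by the new
   generators, makes covers stable under enlarging J. *)
Inductive cover (R : comPzRingType) (f : R) (Q : (R -> Prop) -> Prop) :
    (R -> Prop) -> Prop :=
| cover_leaf J : Q J -> cover f Q J
| cover_node J n (a : 'I_n -> R) :
    (forall K, is_ideal K -> subideal J K ->
       (forall i, exists b, K (1 - b * (1 - a i * f))) -> cover f Q K) ->
    cover f Q J.

Section Cover.

Variables (R : comPzRingType) (f : R).
Implicit Types (Q : (R -> Prop) -> Prop) (J K L : R -> Prop).

Lemma cover_bind Q Q' J :
  is_ideal J -> (forall K, is_ideal K -> subideal J K -> Q K -> cover f Q' K) ->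
  cover f Q J -> cover f Q' J.
Proof.
move=> idJ + cJ; elim: cJ idJ => {}J => [QJ idJ|n a _ IH idJ] QQ'.
  exact: QQ'.
apply: (cover_node (a := a)) => K idK JK Ka; apply: IH => // L idL KL.
by apply: QQ' => // x /JK/KL.
Qed.

(** The moves of the strategy for [adjoin J a] are replayed from [J]; each position [K] of the
    former stays inside [adjoin L a] for the current position [L]. *)
Lemma cover_adjoin Q Q' J a :
  is_ideal J ->
  (forall K L, is_ideal L -> subideal J L -> subideal K (adjoin L a) ->
     Q K -> Q' L) ->
  cover f Q (adjoin J a) -> cover f Q' J.
Proof.
move=> idJ QQ' cJ.
suff : forall L, is_ideal L -> subideal J L ->
    subideal (adjoin J a) (adjoin L a) -> cover f Q' L.
  by apply=> // x.
elim: cJ => {}K => [QK|n b _ IH] L idL JL KL.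
  by apply: cover_leaf; apply: (QQ' K).
apply: (cover_node (a := b)) => M idM LM Mb.
have LMa := adjoinS (a := a) LM.
apply: (IH (adjoin M a)) => //; first exact: ideal_adjoin.
- by move=> x /KL/LMa.
- by move=> i; have [d Md] := Mb i; exists d; apply: adjoin_sub.
- by move=> x /JL/LM.
Qed.

(** Iterated quotients are treated as surjective images of [R]; their kernels are the positions of
    the covering game. *)
Lemma strongly_jacobson_cover J (y : R) :
  cover f (fun K => radical K y) J ->
  forall (S : comPzRingType) (phi : {rmorphism R -> S}),
    (forall z, exists x, phi x = z) -> subideal J (fun x => phi x = 0) ->
    strongly_jacobson_triple (phi f) (phi y).
Proof.
elim=> {}J => [[n Jy]|n a _ IH] S phi phi_surj J_ker.
  by apply: SJ_nil; exists n; rewrite -rmorphXn; apply: J_ker.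
apply: (SJ_quot (a1 := phi \o a)) => a2 u.
have /choice[b bE] := fun i => phi_surj (a2 i).
apply: (IH (fun x => (fgpi u \o phi) x = 0) _ _ _ _ (fgpi u \o phi)) => //.
- exact: (ideal_preim _ (ideal0 _)).
- by move=> x /J_ker /= ->; rewrite rmorph0.
- move=> i; exists (b i); apply/fgpi_eq0/fgidealP.
  exists (fun j => (j == i)%:R); rewrite (bigD1 i) //= eqxx mul1r big1 ?addr0.
    by rewrite /u !(rmorphB, rmorphM, rmorph1) bE.
  by move=> j /negPf->; rewrite mul0r.
- by move=> z; have [v <-] := fgpi_surj z; have [x <-] := phi_surj v; exists x.
Qed.

End Cover.

(** * Polynomials over a strongly Jacobson ring *)

Section Polynomials.

Variable A : comNzRingType.
Implicit Types (J K L : {poly A} -> Prop) (f u : {poly A}).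

(** Replays a strategy of [A] in the polynomial ring. Invariants: [C] is a quotient of [A] whose
    kernel lies in [J], and [y] is a multiple of the coefficient of [u] in degree [n] and, modulo
    [J], of [f]. *)
Lemma cover_strongly_jacobson (C : comPzRingType) (x x' : C) :
  strongly_jacobson_triple x x' ->
  forall (phi : {rmorphism A -> C}) (y y' a : A) J f h u n,
    (forall z, exists b, phi b = z) -> phi y = x -> phi y' = x' ->
    is_ideal J -> J u -> (size u <= n.+1)%N ->
    y = u`_n * a -> J (y%:P - h * f) ->
    (forall b, phi b = 0 -> J b%:P) ->
    cover f (fun K => radical K y'%:P) J.
Proof.
elim=> {C x x'} C x x' => [[k xk]|m a1 _ IH] phi y y' a J f h u n
    phi_surj phiy phiy' idJ Ju su yE Jy kerJ.
  apply: cover_leaf; exists k; rewrite -polyC_exp.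
  by apply: kerJ; rewrite rmorphXn phiy'.
have /choice[b bE] := fun i => phi_surj (a1 i).
(* As [h * f] is [y] modulo [J], this move inverts [1 - b i * y]. An inverse [e i] is then found in
   [A], and [phi (e i)] answers [a1 i]. *)
apply: (cover_node (a := fun i => (b i)%:P * h)) => K idK JK invK.
have [_ KD KM] := idK.
have /choice[e eE] : forall i, exists e, K (1 - e * (1 - b i * y))%:P.
  move=> i; have [t Kt] := invK i.
  apply: (integral_inverse (u := u) (t := t) (n := n) (a := a * b i)) => //.
  - exact: JK.
  - by rewrite yE; congr (1 - _); ring.
  have := KD _ _ Kt (KM (t * (b i)%:P) _ (JK _ Jy)); congr K.
  by rewrite rmorphB rmorphM rmorph1 /=; ring.
apply: (IH (phi \o e)
  (fgpi (fun i => 1 - (phi \o e) i * (1 - a1 i * x)) \o phi)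
  y y' a K f h u n) => //=.
- move=> z; have [v <-] := fgpi_surj z; have [w <-] := phi_surj v.
  by exists w.
- by rewrite phiy.
- by rewrite phiy'.
- exact: JK.
- exact: JK.
move=> d /fgpi_eq0/fgidealP[c dc].
have /choice[c' c'E] := fun i => phi_surj (c i).
(* [s] lifts [phi d] to a constant lying in [K], and [d - s] is in the kernel of [phi]. *)
pose s := \sum_i c' i * (1 - e i * (1 - b i * y)).
rewrite -[d](subrK s) polyCD; apply: KD.
  apply/JK/kerJ; rewrite rmorphB dc rmorph_sum /= -sumrB big1 // => i _.
  by rewrite !(rmorphB, rmorphM, rmorph1) c'E bE phiy subrr.
rewrite rmorph_sum /=; apply: ideal_sum => // i _.
by rewrite polyCM; apply: KM.
Qed.

Hypothesis sjA : strongly_jacobson A.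

Lemma cover_integral f u n k m (p : {poly A}) J :
  is_ideal J -> J u -> (size u <= n.+1)%N ->
  (size p <= m.+1)%N -> p`_m = 1 -> J (p \Po (u`_n ^+ k *: f)) ->
  cover f (fun K => radical K ((u`_n)%:P * f)) J.
Proof.
move=> + + su; set c := u`_n; set F := c ^+ k *: f.
elim: m p J => [|m IHm] p J idJ Ju sp pm Jp; have [J0 JD JM] := idJ.
  apply: cover_leaf; apply: subideal_radical; rewrite -[_ * f]mulr1; apply: JM.
  by move: Jp; rewrite (size1_polyC sp) pm comp_polyC.
pose q := drop_poly 1 p; pose b := p`_0.
have pE : p = q * 'X + b%:P.
  by apply/polyP => -[|i]; rewrite !coefE ?addr0 ?add0r ?addn1.
have sq : (size q <= m.+1)%N by rewrite size_drop_poly leq_subLR.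
have qm : q`_m = 1 by rewrite coef_drop_poly addn1.
have pF : p \Po F = (q \Po F) * F + b%:P by rewrite pE comp_poly_MXaddC.
have FE : F = (c ^+ k)%:P * f by rewrite mul_polyC.
(* The constant c * b is both a multiple of f and a multiple of c. *)
have cb : cover f (fun K => radical K (c * b)%:P) J.
  apply: (cover_strongly_jacobson (sjA (c * b)) (phi := idfun) (y := c * b)
    (a := b) (h := - c%:P * (q \Po F) * (c ^+ k)%:P) (u := u) (n := n)) => //.
  - by move=> z; exists z.
  - by have := JM c%:P _ Jp; congr J; rewrite pF polyCM FE; ring.
  - by move=> d /= ->.
apply: cover_bind cb => // K idK JK Kcb.
(* Since [p \Po F] and [c * b] are nilpotent, so is [(q \Po F) * (c * F)]; modulo [q \Po F] there is
   a monic equation of lower degree. *)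
apply: (@cover_adjoin _ _ (fun L => radical L (c%:P * f)) _ _ (q \Po F)) => //.
  move=> M L idL KL MaL Mf; have idrL := ideal_radical idL.
  have [_ rD rM] := idrL.
  have Lq : radical L ((q \Po F) * (c%:P * F)).
    have -> : (q \Po F) * (c%:P * F) = c%:P * (p \Po F) + - 1 * (c * b)%:P.
      by rewrite pF polyCM; ring.
    apply: (rD); apply: (rM); last exact: radicalS KL _ Kcb.
    by apply: subideal_radical; apply/KL/JK.
  have := radical_adjoinM idL Lq (radicalS MaL Mf) => Lf.
  (* As [F] is [c ^+ k * f], the power [(c * f) ^+ k.+2] equals [f ^+ k * (c * F) * (c * f)]. *)
  apply: (@radical_exp _ _ k.+2).
  have := rM (f ^+ k) _ Lf; congr (radical L _).
  by rewrite FE polyC_exp !exprS exprMn; ring.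
apply: (IHm q) => //; first exact: ideal_adjoin.
- by apply/adjoin_sub/JK.
- exact: adjoin_gen.
Qed.

(** Adjoining the top coefficient [c] removes the top term of [u]; nilpotency of [c * f] brings the
    result back to the ideal without [c], at the cost of a square. *)
Lemma cover_coef f u n J :
  is_ideal J -> J u -> (size u <= n)%N ->
  cover f (fun K => forall i, radical K ((u`_i)%:P * f)) J.
Proof.
elim: n u J => [|n IHn] u J idJ Ju su.
  apply: cover_leaf => i; rewrite nth_default ?(leq_trans su) //.
  by rewrite mul0r; apply: subideal_radical; have [] := idJ.
pose c := u`_n; have [k [p [w [p_monic pw]]]] := pseudo_integral f su.
have cf : cover f (fun K => radical K (c%:P * f)) J.
  apply: (@cover_integral _ _ _ k (size p).-1 p) => //.
  - exact: leqSpred.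
  - exact: monicP.
  - by rewrite pw; have [_ _] := idJ; apply.
apply: cover_bind cf => // K idK JK Kcf.
pose v := u - c%:P * 'X^n.
have vE i : v`_i = if i == n then 0 else u`_i.
  rewrite coefB coefCM coefXn; case: eqP => [->|_]; first by rewrite mulr1 subrr.
  by rewrite mulr0 subr0.
apply: (@cover_adjoin _ _ (fun L => forall i, radical L ((v`_i)%:P * f))
   _ _ c%:P) => //; last first.
  apply: IHn; first exact: ideal_adjoin.
    apply: idealB; first exact: ideal_adjoin.
      by apply/adjoin_sub/JK.
    by apply: idealMr; [exact: ideal_adjoin | exact: adjoin_gen].
  apply/leq_sizeP => j; rewrite vE leq_eqVlt eq_sym; case: eqP => //= _ nj.
  by rewrite nth_default // (leq_trans su).
move=> M L idL KL MaL Mf i; have [<-|ni] := eqVneq n i.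
  exact: radicalS KL _ Kcf.
have := Mf i; rewrite vE eq_sym (negPf ni) => /(radicalS MaL) Lf.
have {}Lf := radical_adjoinM idL (radicalS KL Kcf) Lf.
apply: (@radical_exp _ _ 2); have [_ _ rM] := ideal_radical idL.
have := rM (u`_i)%:P _ Lf; congr (radical L _); ring.
Qed.

Lemma cover_radical f J : is_ideal J -> cover f (fun K => radical K f) J.
Proof.
move=> idJ; apply: (cover_node (n := 1) (a := fun=> 'X))
  => K idK JK /(_ ord0)[g Kg].
set w := 1 - 'X * f in Kg; set u := 1 - g * w in Kg.
apply: cover_bind (cover_coef f idK Kg (leqnn _)) => // L idL _ Lu.
apply: cover_leaf; have idr := ideal_radical idL; have [r0 rD rM] := idr.
(* [I] contains the coefficients of [u = 1 - g * w], so [w] is a unit modulo [I] and its higher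
   coefficients, those of [- f], are nilpotent modulo [I]. *)
pose I (a : A) := radical L (a%:P * f).
have idI : is_ideal I.
  split=> [|a b Ia Ib|a b Ib]; rewrite /I.
  - by rewrite mul0r.
  - by rewrite polyCD mulrDl; apply: rD.
  - by rewrite polyCM -mulrA; apply: rM.
have If i : radical I f`_i.
  have -> : f`_i = - w`_i.+1 by rewrite coefB coef1 coefXM sub0r opprK.
  have [_ _] := ideal_radical idI; rewrite -mulN1r; apply.
  apply: (@coef_unit_nilpotent _ g w (size g) (size w) I) => // [j le_j|j le_j|j].
  - by rewrite nth_default //; case: idI.
  - by rewrite nth_default //; case: idI.
  - by rewrite -opprB coefN; apply: idealN => //; apply: Lu.
have Lf i : radical L ((f`_i)%:P * f).
  have [n In] := If i; apply: (@radical_exp _ _ n.+1).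
  have := rM ((f`_i)%:P * f ^+ n) _ In; congr (radical L _).
  by rewrite polyC_exp exprMn !exprS; ring.
apply: (@radical_exp _ _ 2); rewrite expr2 -{1}[f]coefK poly_def mulr_suml.
apply: ideal_sum => // i _; rewrite -mul_polyC mulrAC; exact: idealMr.
Qed.

Lemma strongly_jacobson_polyring_nz : strongly_jacobson (polyring A).
Proof.
have [F [G FK GK] _] := polyringP A; move=> x; rewrite -(GK x).
apply: (strongly_jacobson_cover (cover_radical (G x) (ideal0 _))).
  by move=> z; exists (G z).
by move=> z ->; rewrite rmorph0.
Qed.

End Polynomials.

(** An equality of rings, rather than an isomorphism, lets the nontrivial case transfer by
    rewriting. *)
Lemma nontrivial_comNzRing (A : comPzRingType) :
  (1 : A) <> 0 -> exists B : comNzRingType, B = A :> comPzRingType.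
Proof.
move=> /eqP A1; pose nz := GRing.PzSemiRing_isNonZero.Build A A1.
pose B : comNzRingType := HB.pack (GRing.ComPzRing.sort A) nz.
by exists B; rewrite {}/B {}/nz; case: A A1 => T [].
Qed.

Theorem theorem30 (A : comPzRingType) :
  strongly_jacobson A -> strongly_jacobson (polyring A).
Proof.
have [A0|/nontrivial_comNzRing[B <-]] := EM ((1 : A) = 0); last first.
  exact: strongly_jacobson_polyring_nz.
move=> _ x; apply: SJ_nil; exists 1%N; apply: pcoef_inj => k.
by rewrite -[LHS]mul1r A0 mul0r.
Qed.
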